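(* Let $\mathcal{C}$ be a $\bar G$-graded $\bar G$-acted $\mathcal{O}$-algebra, and let $A$ and $A'$ be two $\bar G$-graded crossed products over $\mathcal{C}$. Let $\Delta^{\mathcal{C}}=\Delta(A\otimes_{\mathcal{C}}A'^{\mathrm{op}})$. Then the category $\Delta^{\mathcal{C}}\text{-}\mathrm{Mod}$ of $\Delta^{\mathcal{C}}$-modules and the category $A\text{-}\mathrm{Gr}/\mathcal{C}\text{-}A'$ of $\bar G$-graded $(A,A')$-bimodules over $\mathcal{C}$ are equivalent, via the functors $$(A\otimes_{\mathcal{C}}A'^{\mathrm{op}})\otimes_{\Delta^{\mathcal{C}}}-:\ \Delta^{\mathcal{C}}\text{-}\mathrm{Mod}\to A\text{-}\mathrm{Gr}/\mathcal{C}\text{-}A',\qquad (-)_1:\ A\text{-}\mathrm{Gr}/\mathcal{C}\text{-}A'\to\Delta^{\mathcal{C}}\text{-}\mathrm{Mod},$$ where $(-)_1$ denotes taking the identity component (with $\tilde M_1$ a $\Delta^{\mathcal{C}}$-module via $(a\otimes a')m=ama'$), which are quasi-inverse to each other.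
   Context: $\mathcal{O}$ is a complete discrete valuation ring and $\bar G=G/N$, where $G$ is a finite group and $N$ a normal subgroup. A $\bar G$-graded $\mathcal{O}$-algebra $A=\bigoplus_{\bar g\in\bar G}A_{\bar g}$ is a crossed product if each $A_{\bar g}$ contains an invertible element $u_{\bar g}$ of $A$. Let $A$, $A'$ be $\bar G$-graded crossed products with identity components $B=A_1$, $B'=A'_1$ and invertible homogeneous elements $u_{\bar g}\in A_{\bar g}$, $u'_{\bar g}\in A'_{\bar g}$. A $\bar G$-graded $\bar G$-acted $\mathcal{O}$-algebra is a $\bar G$-graded $\mathcal{O}$-algebra $\mathcal{C}=\bigoplus_{\bar g}\mathcal{C}_{\bar g}$ with a left action of $\bar G$ (by $\mathcal{O}$-algebra automorphisms), $c\mapsto{}^{\bar g}c$, such that ${}^{\bar g}\mathcal{C}_{\bar h}\subseteq\mathcal{C}_{\bar g\bar h\bar g^{-1}}$. Example: the centralizer $C_A(B)$ with components $C_A(B)_{\bar h}=C_A(B)\cap A_{\bar h}$ and action ${}^{\bar g}c=u_{\bar g}cu_{\bar g}^{-1}$ (independent of the choice of $u_{\bar g}$). $A$ is over $\mathcal{C}$ if it is equipped with a homomorphism of $\bar G$-graded $\bar G$-acted algebras $\zeta:\mathcal{C}\to C_A(B)$ (grade-preserving and $\bar G$-equivariant). Similarly $A'$ is over $\mathcal{C}$ via $\zeta':\mathcal{C}\to C_{A'}(B')$. $\mathcal{C}$ acts on modules over $A$, $A'$ through $\zeta,\zeta'$. A $\bar G$-graded $(A,A')$-bimodule over $\mathcal{C}$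 is an $(A,A')$-bimodule $\tilde M=\bigoplus_{\bar g}\tilde M_{\bar g}$ with $A_{\bar g}\tilde M_{\bar x}A'_{\bar h}\subseteq\tilde M_{\bar g\bar x\bar h}$ and $\tilde m_{\bar g}\cdot c={}^{\bar g}c\cdot\tilde m_{\bar g}$ for all $c\in\mathcal{C}$, $\tilde m_{\bar g}\in\tilde M_{\bar g}$, $\bar g\in\bar G$. Morphisms in $A\text{-}\mathrm{Gr}/\mathcal{C}\text{-}A'$ are the grade-preserving $(A,A')$-bimodule homomorphisms. $A'^{\mathrm{op}}$ is $\bar G$-graded by $(A'^{\mathrm{op}})_{\bar g}=A'_{\bar g^{-1}}$. The tensor product $A\otimes_{\mathcal{C}}A'^{\mathrm{op}}$ is formed with $ac\otimes a'=a\otimes ca'$, where $ac=a\zeta(c)$ and $ca'=\zeta'(c)a'$ (product in $A'$). $\Delta^{\mathcal{C}}=\Delta(A\otimes_{\mathcal{C}}A'^{\mathrm{op}})$ is its diagonal part, i.e. the $\mathcal{O}$-submodule $\sum_{\bar g\in\bar G}A_{\bar g}\otimes_{\mathcal{C}}A'_{\bar g^{-1}}$ spanned by the elements $a\otimes a'$ with $a\in A_{\bar g}$, $a'\in A'_{\bar g^{-1}}$; it is an $\mathcal{O}$-algebra with $(a\otimes a')(d\otimes d')=ad\otimes d'a'$ (products on the right in $A$ and $A'$). $A\otimes_{\mathcal{C}}A'^{\mathrm{op}}$ is a right $\Delta^{\mathcal{C}}$-module by the same formula, and an $(A,A')$-bimodule via $x(a\otimes a')y=xa\otimes a'y$, $\bar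 G$-graded with $\bar x$-component spanned by $a\otimes a'$, $a\in A_{\bar g}$, $a'\in A'_{\bar h}$, $\bar g\bar h=\bar x$. The grading of $(A\otimes_{\mathcal{C}}A'^{\mathrm{op}})\otimes_{\Delta^{\mathcal{C}}}M$ has $\bar x$-component $(A\otimes_{\mathcal{C}}A'^{\mathrm{op}})_{\bar x}\otimes_{\Delta^{\mathcal{C}}}M$, with the bimodule structure coming from the left factor. *)

(* Defs.v *)
From HB Require Import structures.
From mathcomp Require Import all_boot all_fingroup all_algebra.
From mathcomp Require Import boolp generic_quotient.

Set Implicit Arguments.
Unset Strict Implicit.
Unset Printing Implicit Defensive.

Import GRing.Theory.
Local Open Scope ring_scope.
Local Open Scope quotient_scope.

Definition multiples (R : comNzRingType) (a : R) : R -> Prop :=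
  fun x => exists b, x = b * a.

Definition is_ideal (R : comNzRingType) (I : R -> Prop) : Prop :=
  [/\ I 0, forall x y, I x -> I y -> I (x + y) & forall a x, I x -> I (a * x)].

Definition is_prime_ideal (R : comNzRingType) (I : R -> Prop) : Prop :=
  [/\ is_ideal I, ~ I 1 & forall x y, I (x * y) -> I x \/ I y].

Definition adically_complete (R : comNzRingType) (p : R) : Prop :=
  forall x : nat -> R,
    (forall n, exists k, forall i j,
       (k <= i)%N -> (k <= j)%N -> multiples (p ^+ n) (x i - x j)) ->
    exists l, forall n, exists k, forall i,
       (k <= i)%N -> multiples (p ^+ n) (x i - l).

(* A discrete valuation ring is a principal ideal domain with a unique        *)
(* nonzero prime ideal, here the one generated by p.                          *)
Definition complete_dvr (R : idomainType) : Prop :=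
  (forall I : R -> Prop, is_ideal I ->
     exists a, forall x, I x <-> multiples a x) /\
  exists p : R,
    [/\ p != 0, is_prime_ideal (multiples p),
        forall I : R -> Prop, is_prime_ideal I -> (exists2 x, I x & x != 0) ->
          forall x, I x <-> multiples p x
      & adically_complete p].

Section Tensor.
Variables (M N : zmodType) (R : Type) (mr : M -> R -> M) (rn : R -> N -> N).

(* Presentation of the tensor product by generators and relations: an element *)
(* is a formal sum [:: (m1, n1); ...; (mk, nk)] of pure tensors.  Formal      *)
(* opposites are not needed, since (- m, n) is opposite to (m, n).            *)
Inductive tens_rel : seq (M * N) -> seq (M * N) -> Prop :=
| tens_refl s : tens_rel s s
| tens_sym s t : tens_rel s t -> tens_rel t s
| tens_trans s t u : tens_rel s t -> tens_rel t u -> tens_rel s u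
| tens_cat s s' t t' :
    tens_rel s s' -> tens_rel t t' -> tens_rel (s ++ t) (s' ++ t')
| tens_swap s t : tens_rel (s ++ t) (t ++ s)
| tens_0l n : tens_rel [:: (0, n)] [::]
| tens_Dl m m' n : tens_rel [:: (m + m', n)] [:: (m, n); (m', n)]
| tens_Dr m n n' : tens_rel [:: (m, n + n')] [:: (m, n); (m, n')]
| tens_bal m r n : tens_rel [:: (mr m r, n)] [:: (m, rn r n)].

Definition tens_relb : rel (seq (M * N)) := fun s t => `[< tens_rel s t >].

Lemma tens_relb_equiv : equiv_class_of tens_relb.
Proof.
split=> [s|s t|t s u].
- by apply/asboolP; apply: tens_refl.
- by apply/asboolP/asboolP; apply: tens_sym.
- by move=> /asboolP st /asboolP tu; apply/asboolP; apply: tens_trans tu.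
Qed.
Canonical tens_equiv := EquivRelPack tens_relb_equiv.

Definition tensor : Type := {eq_quot tens_equiv}.
HB.instance Definition _ := Choice.on tensor.
HB.instance Definition _ := EqQuotient.on tensor.

Lemma tens_piP (s t : seq (M * N)) :
  tens_rel s t <-> \pi_tensor s = \pi_tensor t.
Proof.
split=> [st|/eqP]; first by apply/eqP; rewrite piE; apply/asboolP.
by rewrite piE => /asboolP.
Qed.

Definition tens_add (x y : tensor) : tensor := \pi_tensor (repr x ++ repr y).
Definition tens_opp (x : tensor) : tensor :=
  \pi_tensor [seq (- p.1, p.2) | p <- repr x].

Lemma tens_add_pi s t : 
  tens_add (\pi_tensor s) (\pi_tensor t) = \pi_tensor (s ++ t).
Proof.
by apply/tens_piP/tens_cat; apply/tens_piP; rewrite reprK.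
Qed.

Lemma tens_repr (x : tensor) : exists s, x = \pi_tensor s.
Proof. by exists (repr x); rewrite reprK. Qed.

Lemma tens_addA : associative tens_add.
Proof.
move=> x y z; have [s ->] := tens_repr x; have [t ->] := tens_repr y.
have [u ->] := tens_repr z.
by rewrite 4!tens_add_pi catA.
Qed.

Lemma tens_addC : commutative tens_add.
Proof.
move=> x y; have [[s ->] [t ->]] := conj (tens_repr x) (tens_repr y).
by rewrite 2!tens_add_pi; apply/tens_piP/tens_swap.
Qed.

Lemma tens_add0 : left_id (\pi_tensor [::]) tens_add.
Proof. by move=> x; have [s ->] := tens_repr x; rewrite tens_add_pi. Qed.

HB.instance Definition _ := GRing.isNmodule.Build tensor
  tens_addA tens_addC tens_add0.

Definition tens (m : M) (n : N) : tensor := \pi_tensor [:: (m, n)].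

Lemma tens_piD s t : \pi_tensor (s ++ t) = \pi_tensor s + \pi_tensor t.
Proof. by rewrite /GRing.add /= tens_add_pi. Qed.

Lemma tens_piE s : \pi_tensor s = \sum_(p <- s) tens p.1 p.2.
Proof.
elim: s => [|[m n] s IH]; first by rewrite big_nil.
by rewrite big_cons -cat1s tens_piD IH.
Qed.

Lemma tens0l n : tens 0 n = 0.
Proof. by apply/tens_piP/tens_0l. Qed.

Lemma tensDl m m' n : tens (m + m') n = tens m n + tens m' n.
Proof. by rewrite -tens_piD; apply/tens_piP/tens_Dl. Qed.

Lemma tensDr m n n' : tens m (n + n') = tens m n + tens m n'.
Proof. by rewrite -tens_piD; apply/tens_piP/tens_Dr. Qed.

Lemma tens_balance m r n : tens (mr m r) n = tens m (rn r n).
Proof. by apply/tens_piP/tens_bal. Qed.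

Lemma tens_addN : left_inverse 0 tens_opp +%R.
Proof.
move=> x; rewrite -[X in _ + X]reprK /tens_opp !tens_piE big_map.
rewrite -big_split big1 //= => -[m n] _ /=.
by rewrite -tensDl addNr tens0l.
Qed.

HB.instance Definition _ := GRing.Nmodule_isZmodule.Build tensor tens_addN.

Lemma tens_ind (P : tensor -> Prop) :
  P 0 -> (forall m n, P (tens m n)) ->
  (forall x y, P x -> P y -> P (x + y)) -> forall x, P x.
Proof.
move=> P0 P1 PD x; rewrite -[x]reprK tens_piE.
by elim/big_ind: _ => // -[m n] _; apply: P1.
Qed.

Record balanced (V : zmodType) (f : M -> N -> V) : Prop := Balanced {
  balDl : forall m m' n, f (m + m') n = f m n + f m' n;
  balDr : forall m n n', f m (n + n') = f m n + f m n';
  bal_act : forall m r n, f (mr m r) n = f m (rn r n) }.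

(* The additive map with tens m n |-> f m n, meaningful for balanced f only   *)
(* (see tens_liftE).                                                          *)
Definition tens_lift (V : zmodType) (f : M -> N -> V) (x : tensor) : V :=
  \sum_(p <- repr x) f p.1 p.2.

Section Lift.
Variables (V : zmodType) (f : M -> N -> V).
Hypothesis fP : balanced f.

Lemma tens_lift_rel s t : tens_rel s t ->
  \sum_(p <- s) f p.1 p.2 = \sum_(p <- t) f p.1 p.2.
Proof.
elim=> {s t} //= [s t u _ -> //|s s' t t' _ e1 _ e2|s t|n|m m' n|m n n'|m r n].
- by rewrite !big_cat e1 e2.
- by rewrite !big_cat /= addrC.
- rewrite big_seq1 big_nil /=; apply: (addIr (f 0 n)).
  by rewrite -(balDl fP) !add0r.
- by rewrite !big_cons !big_nil !addr0 /= balDl.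
- by rewrite !big_cons !big_nil !addr0 /= balDr.
- by rewrite !big_seq1 /= bal_act.
Qed.

Lemma tens_lift_pi s : tens_lift f (\pi_tensor s) = \sum_(p <- s) f p.1 p.2.
Proof. by apply/tens_lift_rel/tens_piP; rewrite reprK. Qed.

Lemma tens_liftE m n : tens_lift f (tens m n) = f m n.
Proof. by rewrite tens_lift_pi big_seq1. Qed.

Lemma tens_lift0 : tens_lift f 0 = 0.
Proof. by rewrite tens_lift_pi big_nil. Qed.

Lemma tens_liftD x y : tens_lift f (x + y) = tens_lift f x + tens_lift f y.
Proof.
by rewrite -[x]reprK -[y]reprK -tens_piD !tens_lift_pi big_cat.
Qed.
End Lift.

Lemma tens_balanced : balanced tens.
Proof. by split; [apply: tensDl|apply: tensDr|apply: tens_balance]. Qed.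

Lemma eq_additive (V : zmodType) (f g : tensor -> V) :
  {morph f : x y / x + y} -> {morph g : x y / x + y} ->
  (forall m n, f (tens m n) = g (tens m n)) -> f =1 g.
Proof.
move=> fD gD fg; apply: tens_ind => [|//|x y ex ey]; last by rewrite fD gD ex ey.
have h0 (h : tensor -> V) : {morph h : x y / x + y} -> h 0 = 0.
  by move=> hD; apply: (addIr (h 0)); rewrite -hD !add0r.
by rewrite !h0.
Qed.
End Tensor.

Arguments tens {M N R} mr rn.
Arguments tens_lift {M N R mr rn V}.

Section Span.
Variable M : zmodType.

Definition zspan (X : M -> Prop) : {pred M} := fun x =>
  `[< exists2 s : seq M, forall y, y \in s -> X y & x = \sum_(y <- s) y >].

Variable X : M -> Prop.

Lemma zspan_gen x : X x -> x \in zspan X.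
Proof.
move=> Xx; apply/asboolP; exists [:: x]; last by rewrite big_seq1.
by move=> y; rewrite inE => /eqP->.
Qed.

Lemma zspan_ind (P : M -> Prop) :
  P 0 -> (forall x y, P x -> P y -> P (x + y)) -> (forall x, X x -> P x) ->
  forall x, x \in zspan X -> P x.
Proof.
move=> P0 PD PX x /asboolP[s sX ->]; rewrite big_seq.
by elim/big_ind: _ => // y /sX; apply: PX.
Qed.

Lemma zspan_zmod : (forall x, X x -> X (- x)) -> zmod_closed (zspan X).
Proof.
move=> XN.
have spanD x y : x \in zspan X -> y \in zspan X -> x + y \in zspan X.
  move=> /asboolP[s sX ->] /asboolP[t tX ->]; apply/asboolP.
  exists (s ++ t); last by rewrite big_cat.
  by move=> z; rewrite mem_cat => /orP[/sX|/tX].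
split; first by apply/asboolP; exists [::]; rewrite ?big_nil.
move=> x y Xx Xy; apply: (spanD) => //.
have : - y \in zspan X; last by [].
move: y Xy; apply: zspan_ind => [|u v|z /XN]; last exact: zspan_gen.
- by rewrite oppr0; apply/asboolP; exists [::]; rewrite ?big_nil.
- by rewrite opprD; apply: spanD.
Qed.
End Span.

Section Grading.
Variable Q : finGroupType.

Record grading (M : zmodType) := Grading {
  hpart :> Q -> {pred M};
  hpart_zmod : forall g, zmod_closed (hpart g);
  hpart_sum : forall m, exists2 f : Q -> M,
    forall g, f g \in hpart g & m = \sum_g f g;
  hpart_direct : forall f : Q -> M, (forall g, f g \in hpart g) ->
    \sum_g f g = 0 -> forall g, f g = 0 }.

HB.instance Definition _ M (gr : grading M) g :=
  GRing.isZmodClosed.Build M (hpart gr g) (hpart_zmod gr g).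

Record component M (gr : grading M) (g : Q) :=
  Component { cval :> M; cvalP : cval \in hpart gr g }.
HB.instance Definition _ M gr g := [isSub for @cval M gr g].
HB.instance Definition _ M gr g := [Choice of @component M gr g by <:].
HB.instance Definition _ M gr g :=
  [SubChoice_isSubZmodule of @component M gr g by <:].

Section Projection.
Variables (M : zmodType) (gr : grading M).

Definition gproj (g : Q) (m : M) : M := s2val (cid2 (hpart_sum gr m)) g.

Lemma gproj_in g m : gproj g m \in gr g.
Proof. exact: (s2valP (cid2 (hpart_sum gr m)) g). Qed.

Lemma gproj_sum m : \sum_g gproj g m = m.
Proof. by rewrite [RHS](s2valP' (cid2 (hpart_sum gr m))). Qed.

Lemma gproj_uniq f m :
  (forall g, f g \in gr g) -> m = \sum_g f g -> forall g, gproj g m = f g.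
Proof.
move=> fin em g; apply/eqP; rewrite -subr_eq0; apply/eqP.
apply: (@hpart_direct M gr (fun g => gproj g m - f g)) => [h|].
  by rewrite rpredB ?gproj_in.
by rewrite sumrB gproj_sum em subrr.
Qed.

Lemma gprojD g : {morph gproj g : x y / x + y}.
Proof.
move=> x y; apply: (gproj_uniq (f := fun g => gproj g x + gproj g y)) => [h|].
  by rewrite rpredD ?gproj_in.
by rewrite big_split /= !gproj_sum.
Qed.

Lemma gproj0 g : gproj g 0 = 0.
Proof. by apply: (addIr (gproj g 0)); rewrite -gprojD !add0r. Qed.

Lemma gprojN g x : gproj g (- x) = - gproj g x.
Proof. by apply: (addIr (gproj g x)); rewrite -gprojD !addNr gproj0. Qed.

Lemma gproj_sumr g (I : finType) (F : I -> M) :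
  gproj g (\sum_i F i) = \sum_i gproj g (F i).
Proof. exact: (big_morph _ (gprojD g) (gproj0 g)). Qed.

Lemma gproj_hom g h m : m \in gr h -> gproj g m = if g == h then m else 0.
Proof.
move=> mh; apply: (gproj_uniq (f := fun g => if g == h then m else 0)) => [k|].
  by case: eqP => [->|]; rewrite ?rpred0.
by rewrite -big_mkcond big_pred1_eq.
Qed.

Lemma gproj_id g m : m \in gr g -> gproj g m = m.
Proof. by move=> mg; rewrite (gproj_hom g mg) eqxx. Qed.

Lemma grading_ind (P : M -> Prop) :
  (forall x y, P x -> P y -> P (x + y)) ->
  (forall g x, x \in gr g -> P x) -> forall x, P x.
Proof.
move=> PD Ph x; rewrite -(gproj_sum x).
elim/big_ind: _ => [|//|g _]; first by apply: (Ph 1%g); rewrite rpred0.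
by apply: (Ph g); apply: gproj_in.
Qed.
End Projection.

Section FromProjections.
Variables (M : zmodType) (S : Q -> {pred M}) (pr : Q -> M -> M).
Hypotheses (S_zmod : forall g, zmod_closed (S g))
  (prD : forall g, {morph pr g : x y / x + y})
  (pr_in : forall g m, pr g m \in S g)
  (pr_sum : forall m, \sum_g pr g m = m)
  (pr_hom : forall g h m, m \in S h -> pr g m = if g == h then m else 0).

Lemma from_proj_sum m : exists2 f : Q -> M,
  forall g, f g \in S g & m = \sum_g f g.
Proof. by exists (pr^~ m). Qed.

Lemma from_proj_direct (f : Q -> M) : (forall g, f g \in S g) ->
  \sum_g f g = 0 -> forall g, f g = 0.
Proof.
move=> fS f0 g.
have pr0 : pr g 0 = 0 by apply: (addIr (pr g 0)); rewrite -prD !add0r.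
have := congr1 (pr g) f0; rewrite pr0 (big_morph _ (prD g) pr0) => <-.
rewrite (bigD1 g) //= (pr_hom g (fS g)) eqxx big1 ?addr0 // => h hg.
by rewrite (pr_hom g (fS h)) eq_sym (negPf hg).
Qed.

Definition from_proj := Grading S_zmod from_proj_sum from_proj_direct.
End FromProjections.
End Grading.

(* An algebra given by its structure map; unlike GRing.Algebra, this allows   *)
(* the zero algebra.                                                          *)
Record oalgebra (O : comPzRingType) := OAlgebra {
  oalg_ring :> pzRingType;
  oalg : {rmorphism O -> oalg_ring};
  oalg_central : forall (k : O) (a : oalg_ring), oalg k * a = a * oalg k }.
Arguments oalg {O} _.

Record gradedAlg (O : comPzRingType) (Q : finGroupType) := GradedAlg {
  ga_alg :> oalgebra O;
  deg : grading Q ga_alg;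
  deg_scale : forall (k : O) g a, a \in deg g -> oalg ga_alg k * a \in deg g;
  deg_mul : forall g h a b,
    a \in deg g -> b \in deg h -> a * b \in deg (g * h)%g }.
Arguments deg {O Q} _.

Record actedAlg (O : comPzRingType) (Q : finGroupType) := ActedAlg {
  aa_alg :> gradedAlg O Q;
  cact : Q -> {rmorphism aa_alg -> aa_alg};
  cact_oalg : forall g k, cact g (oalg aa_alg k) = oalg aa_alg k;
  cact_one : forall c, cact 1%g c = c;
  cact_mul : forall g h c, cact (g * h)%g c = cact g (cact h c);
  cact_deg : forall g h c, c \in deg aa_alg h ->
    cact g c \in deg aa_alg (g * h * g^-1)%g }.
Arguments cact {O Q} _.

Definition inverses (A : pzRingType) (u v : A) := u * v = 1 /\ v * u = 1.

Definition crossed_product O Q (A : gradedAlg O Q) : Prop :=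
  forall g, exists2 u, u \in deg A g & exists v, inverses u v.

Record crossedOver O Q (C : actedAlg O Q) := CrossedOver {
  co_alg :> gradedAlg O Q;
  co_crossed : crossed_product co_alg;
  zeta : {rmorphism C -> co_alg};
  zeta_oalg : forall k, zeta (oalg C k) = oalg co_alg k;
  zeta_centralizes : forall c b, b \in deg co_alg 1%g ->
    zeta c * b = b * zeta c;
  zeta_deg : forall g c, c \in deg C g -> zeta c \in deg co_alg g;
  zeta_act : forall g c u v, u \in deg co_alg g -> inverses u v ->
    zeta (cact C g c) = u * zeta c * v }.
Arguments zeta {O Q C} _.

Section GradedTheory.
Variables (O : comPzRingType) (Q : finGroupType) (A : gradedAlg O Q).

Lemma gproj_mull g k a x :
  a \in deg A k -> gproj (deg A) g (a * x) = a * gproj (deg A) (k^-1 * g)%g x.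
Proof.
move=> ak; apply: (gproj_uniq
  (f := fun g => a * gproj (deg A) (k^-1 * g)%g x)) => [h|].
  by rewrite -[h in deg A h](mulKVg k); apply: deg_mul; rewrite ?gproj_in.
rewrite -mulr_sumr (reindex_inj (mulgI k)) /=; congr (_ * _).
by under eq_bigr do rewrite mulKg; rewrite gproj_sum.
Qed.

Lemma gproj_mulr g k a x :
  a \in deg A k -> gproj (deg A) g (x * a) = gproj (deg A) (g * k^-1)%g x * a.
Proof.
move=> ak; apply: (gproj_uniq
  (f := fun g => gproj (deg A) (g * k^-1)%g x * a)) => [h|].
  by rewrite -[h in deg A h](mulgKV k); apply: deg_mul; rewrite ?gproj_in.
rewrite -mulr_suml (reindex_inj (mulIg k)) /=; congr (_ * _).
by under eq_bigr do rewrite mulgK; rewrite gproj_sum.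
Qed.

Lemma deg1 : 1 \in deg A 1%g.
Proof.
suff -> : 1 = gproj (deg A) 1%g 1 by apply: gproj_in.
have e1 x : x * gproj (deg A) 1%g 1 = x.
  elim/(grading_ind (gr := deg A)): x => [x y ex ey|g x xg].
    by rewrite mulrDl ex ey.
  by have := gproj_mull g 1 xg; rewrite mulVg mulr1 (gproj_id xg).
by rewrite -[RHS]mul1r e1.
Qed.

Lemma deg_oalg k : oalg A k \in deg A 1%g.
Proof. by rewrite -[oalg A k]mulr1; apply/deg_scale/deg1. Qed.

Lemma deg_inv g u v : u \in deg A g -> inverses u v -> v \in deg A g^-1%g.
Proof.
move=> ug [uv vu]; have := gproj_mull 1 v ug; rewrite uv mulg1 (gproj_id deg1).
by move=> /(congr1 ( *%R v)); rewrite mulr1 mulrA vu mul1r => ->; apply: gproj_in.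
Qed.
End GradedTheory.

Section CrossedTheory.
Variables (O : comPzRingType) (Q : finGroupType).
Variables (C : actedAlg O Q) (A : crossedOver C).

Lemma zeta_comm g c a :
  a \in deg A g -> zeta A (cact C g c) * a = a * zeta A c.
Proof.
move=> ag; have [u ug [v uv]] := co_crossed A g.
have va1 : v * a \in deg A 1%g.
  by rewrite -(mulVg g); apply: deg_mul ag; apply: deg_inv uv.
rewrite (zeta_act c ug uv) -!mulrA [zeta A c * _](zeta_centralizes c va1).
by rewrite !mulrA; case: uv => -> _; rewrite mul1r.
Qed.
End CrossedTheory.

Section TensorOverC.
Variables (O : comPzRingType) (Q : finGroupType) (C : actedAlg O Q).
Variables A A' : crossedOver C.

Definition racts (a : A) (c : C) : A := a * zeta A c.
Definition lacts (c : C) (a' : A') : A' := zeta A' c * a'.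

(* The tensor product of A and A'^op over C; all products below are those of  *)
(* A and of A', so that no multiplication of A'^op is needed.                 *)
Definition tensC : Type := tensor racts lacts.
HB.instance Definition _ := GRing.Zmodule.on tensC.

Definition pureC (a : A) (a' : A') : tensC := tens racts lacts a a'.
Definition liftC (V : zmodType) (f : A -> A' -> V) (t : tensC) : V :=
  tens_lift f t.

Lemma pureCDl a b a' : pureC (a + b) a' = pureC a a' + pureC b a'.
Proof. exact: tensDl. Qed.
Lemma pureCDr a a' b' : pureC a (a' + b') = pureC a a' + pureC a b'.
Proof. exact: tensDr. Qed.
Lemma pureC_act a c a' : pureC (a * zeta A c) a' = pureC a (zeta A' c * a').
Proof. exact: tens_balance. Qed.
Lemma pureC0l a' : pureC 0 a' = 0.
Proof. exact: tens0l. Qed.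
Lemma pureC0r a : pureC a 0 = 0.
Proof. by apply: (addIr (pureC a 0)); rewrite -pureCDr !add0r. Qed.
Lemma pureCNl a a' : pureC (- a) a' = - pureC a a'.
Proof. by apply: (addIr (pureC a a')); rewrite -pureCDl !addNr pureC0l. Qed.
Lemma pureC_suml (I : finType) (F : I -> A) a' :
  pureC (\sum_i F i) a' = \sum_i pureC (F i) a'.
Proof.
exact: (big_morph (pureC^~ a') (fun a b => pureCDl a b a') (pureC0l a')).
Qed.
Lemma pureC_sumr (I : finType) (F : I -> A') a :
  pureC a (\sum_i F i) = \sum_i pureC a (F i).
Proof. exact: (big_morph (pureC a) (pureCDr a) (pureC0r a)). Qed.

Lemma tensC_ind (P : tensC -> Prop) :
  (forall x y, P x -> P y -> P (x + y)) ->
  (forall g h a a', a \in deg A g -> a' \in deg A' h -> P (pureC a a')) ->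
  forall x, P x.
Proof.
move=> PD Pp; apply: tens_ind => [|a a'|//].
  by rewrite -(pureC0l 0); apply: (Pp 1%g 1%g); rewrite rpred0.
change (P (pureC a a')).
elim/(grading_ind (gr := deg A)): a => [a b Pa Pb|g a ag].
  by rewrite pureCDl; apply: PD.
elim/(grading_ind (gr := deg A')): a' => [a' b' Pa Pb|h a' ah].
  by rewrite pureCDr; apply: PD.
exact: Pp ag ah.
Qed.

Definition balancedC (V : zmodType) (f : A -> A' -> V) : Prop :=
  [/\ forall a b a', f (a + b) a' = f a a' + f b a',
      forall a a' b', f a (a' + b') = f a a' + f a b'
    & forall k a c a', c \in deg C k ->
        f (a * zeta A c) a' = f a (zeta A' c * a')].

Lemma balancedCP V f : @balancedC V f -> balanced racts lacts f.
Proof.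
move=> [fDl fDr fb]; split=> // a c a'; rewrite /racts /lacts.
elim/(grading_ind (gr := deg C)): c => [c d ec ed|k c ck]; last exact: fb ck.
by rewrite !rmorphD mulrDr mulrDl fDl fDr ec ed.
Qed.

Lemma liftCE V f a a' : @balancedC V f -> liftC f (pureC a a') = f a a'.
Proof. by move=> /balancedCP fP; apply: tens_liftE. Qed.

Lemma liftCD V f : @balancedC V f -> {morph liftC f : x y / x + y}.
Proof. by move=> /balancedCP fP x y; apply: tens_liftD. Qed.

Lemma morph0 (U V : zmodType) (f : U -> V) : {morph f : x y / x + y} -> f 0 = 0.
Proof. by move=> fD; apply: (addIr (f 0)); rewrite -fD !add0r. Qed.

Lemma tensC_eq (V : zmodType) (f h : tensC -> V) :
  {morph f : x y / x + y} -> {morph h : x y / x + y} ->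
  (forall i j a a', a \in deg A i -> a' \in deg A' j ->
     f (pureC a a') = h (pureC a a')) -> f =1 h.
Proof.
move=> fD hD fh; apply: tensC_ind => [x y ex ey|i j a a' ai aj]; last exact: fh ai aj.
by rewrite fD hD ex ey.
Qed.

Definition tensC_part (x : Q) : {pred tensC} :=
  zspan (fun t => exists g h a a',
    [/\ a \in deg A g, a' \in deg A' h, (g * h)%g = x & t = pureC a a']).

Lemma tensC_part_zmod x : zmod_closed (tensC_part x).
Proof.
apply: zspan_zmod => t [g [h [a [a' [ag ah gh ->]]]]].
by exists g, h, (- a), a'; rewrite rpredN pureCNl.
Qed.

HB.instance Definition _ x :=
  GRing.isZmodClosed.Build tensC (tensC_part x) (tensC_part_zmod x).

Lemma pureC_part g h a a' : a \in deg A g -> a' \in deg A' h ->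
  pureC a a' \in tensC_part (g * h)%g.
Proof. by move=> ag ah; apply: zspan_gen; exists g, h, a, a'. Qed.

Definition tensC_pr0 (x : Q) (a : A) (a' : A') : tensC :=
  \sum_g pureC (gproj (deg A) g a) (gproj (deg A') (g^-1 * x)%g a').

Lemma tensC_pr_bal x : balancedC (tensC_pr0 x).
Proof.
split=> [a b a'|a a' b'|k a c a' ck]; rewrite /tensC_pr0.
- by rewrite -big_split; apply: eq_bigr => g _; rewrite gprojD pureCDl.
- by rewrite -big_split; apply: eq_bigr => g _; rewrite gprojD pureCDr.
rewrite (reindex_inj (mulIg k)) /=; apply: eq_bigr => g _.
rewrite (gproj_mulr _ _ (zeta_deg A ck)) (gproj_mull _ _ (zeta_deg A' ck)).
by rewrite pureC_act mulgK invMg mulgA.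
Qed.

Definition tensC_pr (x : Q) : tensC -> tensC := liftC (tensC_pr0 x).

Lemma tensC_prD x : {morph tensC_pr x : s t / s + t}.
Proof. exact/liftCD/tensC_pr_bal. Qed.

Lemma tensC_pr_pure x g h a a' : a \in deg A g -> a' \in deg A' h ->
  tensC_pr x (pureC a a') = if x == (g * h)%g then pureC a a' else 0.
Proof.
move=> ag ah; rewrite /tensC_pr liftCE; last exact: tensC_pr_bal.
rewrite /tensC_pr0 (bigD1 g) //= big1 => [|i ig]; last first.
  by rewrite (gproj_hom i ag) (negPf ig) pureC0l.
rewrite addr0 (gproj_id ag) (gproj_hom _ ah) -(inj_eq (mulgI g)) mulKVg.
by case: eqP; rewrite ?pureC0r.
Qed.

Lemma tensC_pr_in x t : tensC_pr x t \in tensC_part x.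
Proof.
elim/tensC_ind: t => [s t ps pt|g h a a' ag ah].
  by rewrite tensC_prD rpredD.
rewrite (tensC_pr_pure x ag ah); case: eqP => [->|_]; last exact: rpred0.
exact: pureC_part.
Qed.

Lemma tensC_pr_sum t : \sum_x tensC_pr x t = t.
Proof.
elim/tensC_ind: t => [s t ps pt|g h a a' ag ah].
  by rewrite -[RHS](congr2 +%R ps pt) -big_split; apply: eq_bigr => x _; apply: tensC_prD.
under eq_bigr do rewrite (tensC_pr_pure _ ag ah).
by rewrite -big_mkcond big_pred1_eq.
Qed.

Lemma tensC_pr_hom x y t : t \in tensC_part y ->
  tensC_pr x t = if x == y then t else 0.
Proof.
move: t; apply: zspan_ind => [|s t es et|t [g [h [a [a' [ag ah <- ->]]]]]].
- by rewrite (morph0 (tensC_prD x)) if_same.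
- by rewrite tensC_prD es et; case: eqP; rewrite ?addr0.
- exact: tensC_pr_pure.
Qed.

Definition tensC_grading : grading Q tensC :=
  from_proj tensC_part_zmod tensC_prD tensC_pr_in tensC_pr_sum tensC_pr_hom.

(* The right action (a (x) a') (d (x) d') = a d (x) d' a' of the diagonal     *)
(* part.  For arbitrary d (x) d', the formula is applied to the diagonal      *)
(* component of d (x) d' (see tensC_mul_pure).                                *)
Definition tensC_mul0 (a : A) (a' : A') (d : A) (d' : A') : tensC :=
  \sum_g pureC (a * gproj (deg A) g d) (gproj (deg A') g^-1%g d' * a').
Definition tensC_mul (t s : tensC) : tensC :=
  liftC (fun a a' => liftC (tensC_mul0 a a') s) t.

Lemma tensC_mul0_bal a a' : balancedC (tensC_mul0 a a').
Proof.
split=> [d e d'|d d' e'|k d c d' ck]; rewrite /tensC_mul0.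
- by rewrite -big_split; apply: eq_bigr => g _; rewrite gprojD mulrDr pureCDl.
- by rewrite -big_split; apply: eq_bigr => g _; rewrite gprojD mulrDl pureCDr.
rewrite (reindex_inj (mulIg k)) /=; apply: eq_bigr => g _.
rewrite (gproj_mulr _ _ (zeta_deg A ck)) (gproj_mull _ _ (zeta_deg A' ck)).
by rewrite mulgK invMg mulrA pureC_act mulrA.
Qed.

Lemma tensC_mul1_bal s : balancedC (fun a a' => liftC (tensC_mul0 a a') s).
Proof.
split=> [a b a'|a a' b'|k a c a' ck].
- elim/tensC_ind: s => [s t es et|i j d d' di dj].
    by rewrite !(liftCD (tensC_mul0_bal _ _)) es et addrACA.
  rewrite !(liftCE _ _ (tensC_mul0_bal _ _)) -big_split.
  by apply: eq_bigr => g _; rewrite mulrDl pureCDl.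
- elim/tensC_ind: s => [s t es et|i j d d' di dj].
    by rewrite !(liftCD (tensC_mul0_bal _ _)) es et addrACA.
  rewrite !(liftCE _ _ (tensC_mul0_bal _ _)) -big_split.
  by apply: eq_bigr => g _; rewrite mulrDr pureCDr.
- elim/tensC_ind: s => [s t es et|i j d d' di dj].
    by rewrite !(liftCD (tensC_mul0_bal _ _)) es et.
  rewrite !(liftCE _ _ (tensC_mul0_bal _ _)).
  apply: eq_bigr => g _; rewrite mulrA.
  rewrite -(zeta_comm c (gproj_in (deg A') g^-1%g d')) -[in RHS]mulrA -pureC_act.
  rewrite -!mulrA -(zeta_comm _ (gproj_in (deg A) g d)).
  by rewrite -cact_mul mulgV cact_one.
Qed.

Lemma tensC_mulDl s : {morph tensC_mul^~ s : x y / x + y}.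
Proof. exact/liftCD/tensC_mul1_bal. Qed.

Lemma tensC_mulDr t : {morph tensC_mul t : x y / x + y}.
Proof.
move=> x y; elim/tensC_ind: t => [s t es et|i j a a' _ _].
  by rewrite !tensC_mulDl es et addrACA.
by rewrite /tensC_mul !(liftCE _ _ (tensC_mul1_bal _)) (liftCD (tensC_mul0_bal _ _)).
Qed.

Lemma tensC_mulE a a' d d' :
  tensC_mul (pureC a a') (pureC d d') = tensC_mul0 a a' d d'.
Proof.
by rewrite /tensC_mul (liftCE _ _ (tensC_mul1_bal _)) (liftCE _ _ (tensC_mul0_bal _ _)).
Qed.

Lemma tensC_mul_pure g a a' d d' : d \in deg A g -> d' \in deg A' g^-1%g ->
  tensC_mul (pureC a a') (pureC d d') = pureC (a * d) (d' * a').
Proof.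
move=> dg dg'; rewrite tensC_mulE /tensC_mul0 (bigD1 g) //= big1 => [|i ig].
  by rewrite addr0 !gproj_id.
by rewrite (gproj_hom i dg) (negPf ig) mulr0 pureC0l.
Qed.

Lemma tensC_mul_off g h a a' d d' : d \in deg A g -> d' \in deg A' h ->
  (g * h != 1)%g -> tensC_mul (pureC a a') (pureC d d') = 0.
Proof.
move=> dg dh gh; rewrite tensC_mulE /tensC_mul0 big1 // => i _.
rewrite (gproj_hom i dg); case: eqP => [->|_]; last by rewrite mulr0 pureC0l.
by rewrite (gproj_hom _ dh) eq_invg_mul (negPf gh) mul0r pureC0r.
Qed.

Lemma tensC_mulA r s t : tensC_mul r (tensC_mul s t) = tensC_mul (tensC_mul r s) t.
Proof.
elim/tensC_ind: r => [r r' er er'|i j a a' ai aj].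
  by rewrite !tensC_mulDl er er'.
elim/tensC_ind: s => [s s' es es'|g h d d' dg dh].
  by rewrite tensC_mulDl !tensC_mulDr tensC_mulDl es es'.
elim/tensC_ind: t => [t t' et et'|k l e e' ek el].
  by rewrite !tensC_mulDr et et'.
have [kl|kl] := eqVneq (k * l)%g 1%g; last first.
  have off0 u : tensC_mul u (pureC e e') = 0.
    elim/tensC_ind: u => [u v eu ev|u v b b' _ _].
      by rewrite tensC_mulDl eu ev addr0.
    by rewrite (tensC_mul_off _ _ ek el kl).
  by rewrite !off0 (morph0 (tensC_mulDr _)).
have el' : e' \in deg A' k^-1%g by move/eqP: kl; rewrite -eq_invg_mul => /eqP->.
rewrite (tensC_mul_pure _ _ ek el').
have [gh|gh] := eqVneq (g * h)%g 1%g; last first.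
  rewrite (tensC_mul_off _ _ dg dh gh) (morph0 (tensC_mulDl _)).
  apply: (tensC_mul_off _ _ (deg_mul dg ek) (deg_mul el' dh)).
  by rewrite mulgA mulgK.
have dh' : d' \in deg A' g^-1%g by move/eqP: gh; rewrite -eq_invg_mul => /eqP->.
rewrite (tensC_mul_pure _ _ dg dh') (tensC_mul_pure _ _ ek el').
rewrite (tensC_mul_pure _ _ (deg_mul dg ek)) ?invMg ?deg_mul //.
by rewrite !mulrA.
Qed.

Definition tensC_one : tensC := pureC 1 1.

Lemma tensC_mulr1 t : tensC_mul t tensC_one = t.
Proof.
elim/tensC_ind: t => [s t es et|i j a a' ai aj]; first by rewrite tensC_mulDl es et.
by rewrite (@tensC_mul_pure 1%g) ?invg1 ?deg1 // mulr1 mul1r.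
Qed.

Lemma tensC_mul1r t : tensC_mul tensC_one t = tensC_pr 1%g t.
Proof.
elim/tensC_ind: t => [s t es et|i j a a' ai aj].
  by rewrite tensC_mulDr tensC_prD es et.
rewrite (tensC_pr_pure _ ai aj); case: eqVneq => [ij|ij].
  rewrite (tensC_mul_pure _ _ ai) ?mul1r ?mulr1 //.
  by move/eqP: ij; rewrite eq_sym -eq_invg_mul => /eqP->.
by rewrite (tensC_mul_off _ _ ai aj) // eq_sym.
Qed.

Lemma tensC_mul_part x t s : t \in tensC_part x -> tensC_mul t s \in tensC_part x.
Proof.
move: t; apply: zspan_ind => [|t u pt pu|t [g [h [a [a' [ag ah <- ->]]]]]].
- by rewrite (morph0 (tensC_mulDl _)) rpred0.
- by rewrite tensC_mulDl rpredD.
elim/tensC_ind: s => [s u ps pu|k l d d' dk dl].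
  by rewrite tensC_mulDr rpredD.
have [kl|kl] := eqVneq (k * l)%g 1%g; last first.
  by rewrite (tensC_mul_off _ _ dk dl kl) rpred0.
move/eqP: kl; rewrite -eq_invg_mul => /eqP ekl; rewrite -ekl in dl.
rewrite (tensC_mul_pure _ _ dk dl).
have -> : (g * h = (g * k) * (k^-1 * h))%g by rewrite mulgA mulgK.
by apply: pureC_part; apply: deg_mul.
Qed.

Lemma tensC_pr_mul x t s : tensC_pr x (tensC_mul t s) = tensC_mul (tensC_pr x t) s.
Proof.
elim/tensC_ind: t => [t u et eu|g h a a' ag ah].
  by rewrite tensC_mulDl !tensC_prD tensC_mulDl et eu.
rewrite (tensC_pr_hom x (tensC_mul_part s (pureC_part ag ah))).
rewrite (tensC_pr_pure x ag ah); case: eqP => // _.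
by rewrite (morph0 (tensC_mulDl _)).
Qed.

(* x (a (x) a') y = x a (x) a' y, where a' y is a product in A'.              *)
Definition tensC_lact (x : A) : tensC -> tensC :=
  liftC (fun a a' => pureC (x * a) a').
Definition tensC_ract (t : tensC) (y : A') : tensC :=
  liftC (fun a a' => pureC a (a' * y)) t.

Lemma tensC_lact_bal x : balancedC (fun a a' => pureC (x * a) a').
Proof.
split=> *; first by rewrite mulrDr pureCDl.
  by rewrite pureCDr.
by rewrite mulrA pureC_act.
Qed.
Lemma tensC_ract_bal y : balancedC (fun a a' => pureC a (a' * y)).
Proof.
split=> *; first by rewrite pureCDl.
  by rewrite mulrDl pureCDr.
by rewrite pureC_act mulrA.
Qed.

Lemma tensC_lactE x a a' : tensC_lact x (pureC a a') = pureC (x * a) a'.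
Proof. exact/liftCE/tensC_lact_bal. Qed.
Lemma tensC_ractE a a' y : tensC_ract (pureC a a') y = pureC a (a' * y).
Proof. exact/liftCE/tensC_ract_bal. Qed.
Lemma tensC_lactD x : {morph tensC_lact x : s t / s + t}.
Proof. exact/liftCD/tensC_lact_bal. Qed.
Lemma tensC_ractD y : {morph tensC_ract^~ y : s t / s + t}.
Proof. exact/liftCD/tensC_ract_bal. Qed.

Lemma tensC_lact_mul x t s :
  tensC_lact x (tensC_mul t s) = tensC_mul (tensC_lact x t) s.
Proof.
elim/tensC_ind: t => [t u et eu|i j a a' _ _].
  by rewrite tensC_mulDl !tensC_lactD tensC_mulDl et eu.
elim/tensC_ind: s => [s u es eu|g h d d' dg dh].
  by rewrite !tensC_mulDr tensC_lactD es eu.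
rewrite tensC_lactE !tensC_mulE (big_morph _ (tensC_lactD x) (morph0 (tensC_lactD x))).
by apply: eq_bigr => k _; rewrite tensC_lactE mulrA.
Qed.

Lemma tensC_ract_mul y t s :
  tensC_ract (tensC_mul t s) y = tensC_mul (tensC_ract t y) s.
Proof.
elim/tensC_ind: t => [t u et eu|i j a a' _ _].
  by rewrite tensC_mulDl !tensC_ractD tensC_mulDl et eu.
elim/tensC_ind: s => [s u es eu|g h d d' dg dh].
  by rewrite !tensC_mulDr tensC_ractD es eu.
rewrite tensC_ractE !tensC_mulE (big_morph _ (tensC_ractD y) (morph0 (tensC_ractD y))).
by apply: eq_bigr => k _; rewrite tensC_ractE mulrA.
Qed.

(* The 1-component is spanned by the a (x) a' with a of degree g and a' of    *)
(* degree g^-1, i.e., it is the diagonal part.                                *)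
Definition Delta : Type := component tensC_grading 1%g.
HB.instance Definition _ := SubType.on Delta.
HB.instance Definition _ := GRing.Zmodule.on Delta.
Definition Delta_val (t : Delta) : tensC := cval t.

Lemma Delta_valP (t : Delta) : Delta_val t \in tensC_part 1%g.
Proof. exact: (cvalP t). Qed.
Lemma Delta_val_inj : injective Delta_val.
Proof. exact: val_inj. Qed.
Lemma Delta_valD : {morph Delta_val : s t / s + t}.
Proof. by []. Qed.

Definition Delta_mul (t s : Delta) : Delta :=
  @Component _ _ tensC_grading 1%g
    (tensC_mul (Delta_val t) (Delta_val s)) (tensC_mul_part _ (Delta_valP t)).

Lemma tensC_one_part : tensC_one \in tensC_part 1%g.
Proof. by rewrite -[1%g]mulg1; apply/pureC_part; apply/deg1. Qed.

Definition Delta_one : Delta :=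
  @Component _ _ tensC_grading 1%g tensC_one tensC_one_part.

Lemma Delta_mulA : associative Delta_mul.
Proof. by move=> r s t; apply/Delta_val_inj/tensC_mulA. Qed.
Lemma Delta_mul1r : left_id Delta_one Delta_mul.
Proof.
move=> t; apply: Delta_val_inj; rewrite [LHS]tensC_mul1r.
by rewrite (tensC_pr_hom _ (Delta_valP t)) eqxx.
Qed.
Lemma Delta_mulr1 : right_id Delta_one Delta_mul.
Proof. by move=> t; apply/Delta_val_inj/tensC_mulr1. Qed.
Lemma Delta_mulDl : left_distributive Delta_mul +%R.
Proof. by move=> r s t; apply/Delta_val_inj/tensC_mulDl. Qed.
Lemma Delta_mulDr : right_distributive Delta_mul +%R.
Proof. by move=> r s t; apply/Delta_val_inj/tensC_mulDr. Qed.

HB.instance Definition _ := GRing.Zmodule_isPzRing.Build Delta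
  Delta_mulA Delta_mul1r Delta_mulr1 Delta_mulDl Delta_mulDr.

Lemma Delta_valM (t s : Delta) :
  Delta_val (t * s) = tensC_mul (Delta_val t) (Delta_val s).
Proof. by []. Qed.
Lemma Delta_val1 : Delta_val 1 = tensC_one.
Proof. by []. Qed.
End TensorOverC.
Arguments tensC_part {O Q C} A A' x.
Arguments tensC_one {O Q C} A A'.
Arguments tensC_grading {O Q C} A A'.

Record category := Category {
  obj :> Type;
  hom : obj -> obj -> Type;
  idm : forall x, hom x x;
  cmp : forall x y z, hom y z -> hom x y -> hom x z;
  cmp_idl : forall x y (f : hom x y), cmp (idm y) f = f;
  cmp_idr : forall x y (f : hom x y), cmp f (idm x) = f;
  cmp_assoc : forall w x y z (h : hom y z) (g : hom x y) (f : hom w x),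
    cmp h (cmp g f) = cmp (cmp h g) f }.
Arguments hom {_}.
Arguments idm {_}.
Arguments cmp {_ _ _ _}.

Record functor (X Y : category) := Functor {
  fobj :> X -> Y;
  fmap : forall x y, hom x y -> hom (fobj x) (fobj y);
  fmap_id : forall x, fmap (idm x) = idm (fobj x);
  fmap_cmp : forall x y z (g : hom y z) (f : hom x y),
    fmap (cmp g f) = cmp (fmap g) (fmap f) }.
Arguments fmap {X Y} _ {x y}.

Definition id_functor (X : category) : functor X X :=
  @Functor X X id (fun _ _ f => f) (fun _ => erefl) (fun _ _ _ _ _ => erefl).

Section CompFunctor.
Variables (X Y Z : category) (G : functor Y Z) (F : functor X Y).
Lemma comp_functor_id x : fmap G (fmap F (idm x)) = idm (G (F x)).
Proof. by rewrite !fmap_id. Qed.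
Lemma comp_functor_cmp x y z (g : hom y z) (f : hom x y) :
  fmap G (fmap F (cmp g f)) = cmp (fmap G (fmap F g)) (fmap G (fmap F f)).
Proof. by rewrite !fmap_cmp. Qed.
Definition comp_functor : functor X Z :=
  @Functor X Z (fun x => G (F x)) (fun _ _ f => fmap G (fmap F f))
    comp_functor_id comp_functor_cmp.
End CompFunctor.

Definition naturally_isomorphic (X Y : category) (F G : functor X Y) : Prop :=
  exists (eta : forall x, hom (F x) (G x)) (theta : forall x, hom (G x) (F x)),
    [/\ forall x y (f : hom x y),
          cmp (eta y) (fmap F f) = cmp (fmap G f) (eta x),
        forall x, cmp (theta x) (eta x) = idm (F x)
      & forall x, cmp (eta x) (theta x) = idm (G x)].

Definition quasi_inverse (X Y : category) (F : functor X Y) (G : functor Y X) :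
    Prop :=
  naturally_isomorphic (comp_functor G F) (id_functor X) /\
  naturally_isomorphic (comp_functor F G) (id_functor Y).

Lemma linear_eq (R : pzRingType) (U V : lmodType R) (f g : {linear U -> V}) :
  f =1 g -> f = g.
Proof.
move=> /funext; case: f => f [[a] [b]]; case: g => g [[c] [d]] /= fg.
case: _ / fg in c d *.
by rewrite (Prop_irrelevance a c) (Prop_irrelevance b d).
Qed.

Definition mod_cat (R : pzRingType) : category :=
  @Category (lmodType R) (fun M N => {linear M -> N})
    (fun M => idfun) (fun M N P g f => g \o f)
    (fun M N f => @linear_eq R M N (idfun \o f) f (fun=> erefl))
    (fun M N f => @linear_eq R M N (f \o idfun) f (fun=> erefl))
    (fun M N P L h g f =>
       @linear_eq R M L (h \o (g \o f)) ((h \o g) \o f) (fun=> erefl)).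

Section Bimodules.
Variables (O : comPzRingType) (Q : finGroupType) (C : actedAlg O Q).
Variables A A' : crossedOver C.

(* For c = k * 1 with k : O, gb_over says that O acts in the same way on both *)
(* sides.                                                                     *)
Record grBimod := GrBimod {
  gb_sort :> lmodType A;
  ract : gb_sort -> A' -> gb_sort;
  ractDl : forall y, {morph ract^~ y : m n / m + n};
  ractDr : forall m, {morph ract m : y z / y + z};
  ract1 : forall m, ract m 1 = m;
  ractM : forall m y z, ract m (y * z) = ract (ract m y) z;
  ract_scale : forall a m y, ract (a *: m) y = a *: ract m y;
  gb_deg : grading Q gb_sort;
  gb_deg_mul : forall g x h a m y,
    a \in deg A g -> m \in gb_deg x -> y \in deg A' h ->
    ract (a *: m) y \in gb_deg (g * x * h)%g;
  gb_over : forall g m c, m \in gb_deg g ->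
    ract m (zeta A' c) = zeta A (cact C g c) *: m }.

Record grHom (M N : grBimod) := GrHom {
  gh_fun :> {linear M -> N};
  gh_ract : forall m y, gh_fun (ract m y) = ract (gh_fun m) y;
  gh_deg : forall g m, m \in gb_deg M g -> gh_fun m \in gb_deg N g }.

Lemma grHom_eq M N (f g : grHom M N) : f =1 g -> f = g.
Proof.
case: f g => [f fr fd] [g gr gd] /= /linear_eq fg; case: _ / fg in gr gd *.
by rewrite (Prop_irrelevance fr gr) (Prop_irrelevance fd gd).
Qed.

Definition grHom_id M : grHom M M :=
  @GrHom M M idfun (fun _ _ => erefl) (fun _ _ mg => mg).

Section Comp.
Variables (M N P : grBimod) (g : grHom N P) (f : grHom M N).
Lemma grHom_comp_ract m y : (g \o f) (ract m y) = ract ((g \o f) m) y.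
Proof. by rewrite /= !gh_ract. Qed.
Lemma grHom_comp_deg x m : m \in gb_deg M x -> (g \o f) m \in gb_deg P x.
Proof. by move=> mx /=; do 2 apply: gh_deg. Qed.
Definition grHom_comp : grHom M P :=
  @GrHom M P (g \o f) grHom_comp_ract grHom_comp_deg.
End Comp.

Definition grBimod_cat : category :=
  @Category grBimod grHom grHom_id grHom_comp
    (fun M N f => @grHom_eq M N (grHom_comp (grHom_id N) f) f (fun=> erefl))
    (fun M N f => @grHom_eq M N (grHom_comp f (grHom_id M)) f (fun=> erefl))
    (fun M N P L h g f => @grHom_eq M L (grHom_comp h (grHom_comp g f))
       (grHom_comp (grHom_comp h g) f) (fun=> erefl)).

Lemma ract0l (M : grBimod) y : ract (0 : M) y = 0.
Proof. exact: (morph0 (@ractDl M y)). Qed.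

Section IdentityComponent.
Variable M : grBimod.

(* For m of degree 1 the action of a (x) a' on m is a m a'. *)
Definition tensC_act (t : tensC A A') (m : M) : M :=
  liftC (fun a a' => ract (a *: m) a') t.

Lemma tensC_act_bal m : m \in gb_deg M 1%g ->
  balancedC (fun (a : A) (a' : A') => ract (a *: m) a').
Proof.
move=> m1; split=> [a b a'|a a' b'|k a c a' _].
- by rewrite scalerDl ractDl.
- by rewrite ractDr.
by rewrite -scalerA ractM (ract_scale a m) (gb_over c m1) cact_one.
Qed.

Lemma tensC_act_pure m a a' : m \in gb_deg M 1%g ->
  tensC_act (pureC a a') m = ract (a *: m) a'.
Proof. by move=> m1; rewrite /tensC_act (liftCE _ _ (tensC_act_bal m1)). Qed.

Lemma tensC_actDl m : m \in gb_deg M 1%g ->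
  {morph tensC_act^~ m : s t / s + t}.
Proof. by move=> m1; apply/liftCD/tensC_act_bal. Qed.

Lemma tensC_actDr t m n : m \in gb_deg M 1%g -> n \in gb_deg M 1%g ->
  tensC_act t (m + n) = tensC_act t m + tensC_act t n.
Proof.
move=> m1 n1; have mn1 : m + n \in gb_deg M 1%g by rewrite rpredD.
elim/tensC_ind: t => [s t es et|i j a a' _ _].
  by rewrite !tensC_actDl // es et addrACA.
by rewrite !tensC_act_pure // scalerDr ractDl.
Qed.

Lemma tensC_act_deg x t m : t \in tensC_part A A' x -> m \in gb_deg M 1%g ->
  tensC_act t m \in gb_deg M x.
Proof.
move=> tx m1; move: t tx.
apply: zspan_ind => [|s t ps pt|t [g [h [a [a' [ag ah <- ->]]]]]].
- by rewrite (morph0 (tensC_actDl m1)) rpred0.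
- by rewrite tensC_actDl // rpredD.
by rewrite tensC_act_pure // -[g]mulg1; apply: gb_deg_mul.
Qed.

Lemma tensC_act_mul t s m : s \in tensC_part A A' 1%g -> m \in gb_deg M 1%g ->
  tensC_act (tensC_mul t s) m = tensC_act t (tensC_act s m).
Proof.
move=> s1 m1; have sm1 := tensC_act_deg s1 m1.
elim/tensC_ind: t sm1 => [t u et eu|i j a a' _ _] sm1.
  by rewrite tensC_mulDl !tensC_actDl // et ?eu.
rewrite [RHS]tensC_act_pure // {sm1}.
move: s s1; apply: zspan_ind => [|s u es eu|s [g [h [d [d' [dg dh gh ->]]]]]].
- rewrite (morph0 (tensC_mulDr _)) !(morph0 (tensC_actDl m1)).
  by rewrite scaler0 ract0l.
- by rewrite tensC_mulDr !tensC_actDl // es eu scalerDr ractDl.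
have eh : h = g^-1%g by apply/eqP; rewrite eq_sym eq_invg_mul gh.
rewrite {}eh in dh gh; rewrite (tensC_mul_pure _ _ dg dh) !tensC_act_pure //.
by rewrite -scalerA ractM !ract_scale.
Qed.

Lemma tensC_act1 m : m \in gb_deg M 1%g -> tensC_act (tensC_one A A') m = m.
Proof. by move=> m1; rewrite tensC_act_pure // scale1r ract1. Qed.

Definition idcomp : Type := component (gb_deg M) 1%g.
HB.instance Definition _ := SubType.on idcomp.
HB.instance Definition _ := GRing.Zmodule.on idcomp.
Definition idcomp_val (m : idcomp) : M := cval m.

Lemma idcomp_valP (m : idcomp) : idcomp_val m \in gb_deg M 1%g.
Proof. exact: (cvalP m). Qed.
Lemma idcomp_val_inj : injective idcomp_val.
Proof. exact: val_inj. Qed.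

Definition idcomp_scale (t : Delta A A') (m : idcomp) : idcomp :=
  @Component _ _ (gb_deg M) 1%g (tensC_act (Delta_val t) (idcomp_val m))
    (tensC_act_deg (Delta_valP t) (idcomp_valP m)).

Lemma idcomp_scaleA s t m :
  idcomp_scale s (idcomp_scale t m) = idcomp_scale (s * t) m.
Proof.
apply: idcomp_val_inj; symmetry.
exact: tensC_act_mul (Delta_valP t) (idcomp_valP m).
Qed.
Lemma idcomp_scale1 : left_id 1 idcomp_scale.
Proof. by move=> m; apply/idcomp_val_inj/tensC_act1/idcomp_valP. Qed.
Lemma idcomp_scaleDr : right_distributive idcomp_scale +%R.
Proof.
by move=> t m n; apply/idcomp_val_inj/tensC_actDr; apply: idcomp_valP.
Qed.
Lemma idcomp_scaleDl m : {morph idcomp_scale^~ m : s t / s + t}.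
Proof. by move=> s t; apply/idcomp_val_inj/tensC_actDl/idcomp_valP. Qed.

HB.instance Definition _ := GRing.Zmodule_isLmodule.Build (Delta A A') idcomp
  idcomp_scaleA idcomp_scale1 idcomp_scaleDr idcomp_scaleDl.
End IdentityComponent.

Section IdentityComponentMap.
Variables (M N : grBimod) (f : grHom M N).

Definition idcomp_map (m : idcomp M) : idcomp N :=
  @Component _ _ (gb_deg N) 1%g (f (idcomp_val m)) (gh_deg f (idcomp_valP m)).

Lemma tensC_act_map t m : m \in gb_deg M 1%g ->
  f (tensC_act t m) = tensC_act t (f m).
Proof.
move=> m1; have fm1 := gh_deg f m1.
elim/tensC_ind: t => [s t es et|i j a a' _ _].
  by rewrite !tensC_actDl // raddfD /= es et.
by rewrite !tensC_act_pure // gh_ract linearZ.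
Qed.

Lemma idcomp_map_linear : linear idcomp_map.
Proof.
move=> t m n; apply: idcomp_val_inj; rewrite /= /idcomp_map /=.
rewrite [LHS](raddfD f) /=; congr (_ + _).
exact: tensC_act_map (idcomp_valP m).
Qed.
HB.instance Definition _ :=
  GRing.isLinear.Build (Delta A A') (idcomp M) (idcomp N) _ idcomp_map
    idcomp_map_linear.
End IdentityComponentMap.

Lemma idcomp_map_id M : idcomp_map (grHom_id M) = idfun :> {linear _ -> _}.
Proof. by apply: linear_eq => m; apply: idcomp_val_inj. Qed.
Lemma idcomp_map_comp M N P (g : grHom N P) (f : grHom M N) :
  idcomp_map (grHom_comp g f) = idcomp_map g \o idcomp_map f :> {linear _ -> _}.
Proof. by apply: linear_eq => m; apply: idcomp_val_inj. Qed.

Definition idcomp_functor : functor grBimod_cat (mod_cat (Delta A A')) :=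
  @Functor grBimod_cat (mod_cat (Delta A A')) idcomp
    (fun M N f => idcomp_map f) idcomp_map_id idcomp_map_comp.
End Bimodules.

Section Induction.
Variables (O : comPzRingType) (Q : finGroupType) (C : actedAlg O Q).
Variables A A' : crossedOver C.
Local Notation T := (tensC A A').
Local Notation D := (Delta A A').

Section Object.
Variable M : lmodType D.

Definition diag_ract (t : T) (s : D) : T := tensC_mul t (Delta_val s).
Definition diag_lact (s : D) (m : M) : M := s *: m.

(* (A (x)_C A'^op) (x)_Delta M *)
Definition ind : Type := tensor diag_ract diag_lact.
HB.instance Definition _ := GRing.Zmodule.on ind.

Definition pureI (t : T) (m : M) : ind := tens diag_ract diag_lact t m.
Definition liftI (V : zmodType) (f : T -> M -> V) (x : ind) : V := tens_lift f x.
Definition balancedI (V : zmodType) (f : T -> M -> V) :=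
  balanced diag_ract diag_lact f.

Lemma pureIDl s t m : pureI (s + t) m = pureI s m + pureI t m.
Proof. exact: tensDl. Qed.
Lemma pureIDr t m n : pureI t (m + n) = pureI t m + pureI t n.
Proof. exact: tensDr. Qed.
Lemma pureI_mul t s m : pureI (tensC_mul t (Delta_val s)) m = pureI t (s *: m).
Proof. exact: tens_balance. Qed.
Lemma pureI0l m : pureI 0 m = 0.
Proof. exact: tens0l. Qed.
Lemma pureINl t m : pureI (- t) m = - pureI t m.
Proof. by apply: (addIr (pureI t m)); rewrite -pureIDl !addNr pureI0l. Qed.
Lemma pureI_suml (I : finType) (F : I -> T) m :
  pureI (\sum_i F i) m = \sum_i pureI (F i) m.
Proof. exact: (big_morph (pureI^~ m) (fun s t => pureIDl s t m) (pureI0l m)). Qed.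

Lemma ind_ind (P : ind -> Prop) :
  (forall x y, P x -> P y -> P (x + y)) ->
  (forall g t m, t \in tensC_part A A' g -> P (pureI t m)) -> forall x, P x.
Proof.
move=> PD Pp; apply: tens_ind => [|t m|//].
  by rewrite -(pureI0l 0); apply: (Pp 1%g); rewrite rpred0.
change (P (pureI t m)).
elim/(grading_ind (gr := tensC_grading A A')): t => [s t Ps Pt|g t].
  by rewrite pureIDl; apply: PD.
exact: Pp.
Qed.

Lemma liftIE V f t m : @balancedI V f -> liftI f (pureI t m) = f t m.
Proof. by move=> fP; apply: tens_liftE. Qed.
Lemma liftID V f : @balancedI V f -> {morph liftI f : x y / x + y}.
Proof. by move=> fP x y; apply: tens_liftD. Qed.

Lemma balancedI_map (h : T -> T) :
  {morph h : s t / s + t} ->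
  (forall s t, h (tensC_mul s t) = tensC_mul (h s) t) ->
  balancedI (fun t m => pureI (h t) m).
Proof.
move=> hD hM; split=> [s t m|t m n|t s m].
- by rewrite hD pureIDl.
- by rewrite pureIDr.
by rewrite hM pureI_mul.
Qed.

Definition ind_scale (x : A) : ind -> ind :=
  liftI (fun t m => pureI (tensC_lact x t) m).
Definition ind_ract (z : ind) (y : A') : ind :=
  liftI (fun t m => pureI (tensC_ract t y) m) z.
Definition ind_pr (g : Q) : ind -> ind :=
  liftI (fun t m => pureI (tensC_pr g t) m).

Lemma ind_scale_bal x : balancedI (fun t m => pureI (tensC_lact x t) m).
Proof. by apply: balancedI_map; [apply: tensC_lactD|apply: tensC_lact_mul]. Qed.
Lemma ind_ract_bal y : balancedI (fun t m => pureI (tensC_ract t y) m).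
Proof. by apply: balancedI_map; [apply: tensC_ractD|apply: tensC_ract_mul]. Qed.
Lemma ind_pr_bal g : balancedI (fun t m => pureI (tensC_pr g t) m).
Proof. by apply: balancedI_map; [apply: tensC_prD|apply: tensC_pr_mul]. Qed.

Lemma ind_scaleE x t m : ind_scale x (pureI t m) = pureI (tensC_lact x t) m.
Proof. exact/liftIE/ind_scale_bal. Qed.
Lemma ind_ractE t m y : ind_ract (pureI t m) y = pureI (tensC_ract t y) m.
Proof. exact/liftIE/ind_ract_bal. Qed.
Lemma ind_prE g t m : ind_pr g (pureI t m) = pureI (tensC_pr g t) m.
Proof. exact/liftIE/ind_pr_bal. Qed.
Lemma ind_prD g : {morph ind_pr g : x y / x + y}.
Proof. exact/liftID/ind_pr_bal. Qed.

Lemma ind_scaleDr : right_distributive ind_scale +%R.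
Proof. by move=> x; apply/liftID/ind_scale_bal. Qed.
Lemma ind_scaleDl z : {morph ind_scale^~ z : x y / x + y}.
Proof.
move=> x y; elim/ind_ind: z => [z w ez ew|g t m _].
  by rewrite !ind_scaleDr ez ew addrACA.
rewrite !ind_scaleE -pureIDl; congr pureI.
elim/tensC_ind: t => [s t es et|i j a a' _ _].
  by rewrite !tensC_lactD es et addrACA.
by rewrite !tensC_lactE mulrDl pureCDl.
Qed.
Lemma ind_scaleA x y z : ind_scale x (ind_scale y z) = ind_scale (x * y) z.
Proof.
elim/ind_ind: z => [z w ez ew|g t m _]; first by rewrite !ind_scaleDr ez ew.
rewrite !ind_scaleE; congr pureI.
elim/tensC_ind: t => [s t es et|i j a a' _ _].
  by rewrite !tensC_lactD es et.
by rewrite !tensC_lactE mulrA.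
Qed.
Lemma ind_scale1 : left_id 1 ind_scale.
Proof.
move=> z; elim/ind_ind: z => [z w ez ew|g t m _].
  by rewrite ind_scaleDr ez ew.
rewrite ind_scaleE; congr pureI.
elim/tensC_ind: t => [s t es et|i j a a' _ _].
  by rewrite tensC_lactD es et.
by rewrite tensC_lactE mul1r.
Qed.

HB.instance Definition _ := GRing.Zmodule_isLmodule.Build A ind
  ind_scaleA ind_scale1 ind_scaleDr ind_scaleDl.

Lemma ind_scale_pure x t m : x *: pureI t m = pureI (tensC_lact x t) m.
Proof. exact: ind_scaleE. Qed.

Lemma ind_ractDl y : {morph ind_ract^~ y : z w / z + w}.
Proof. exact/liftID/ind_ract_bal. Qed.
Lemma ind_ractDr z : {morph ind_ract z : x y / x + y}.
Proof.
move=> x y; elim/ind_ind: z => [z w ez ew|g t m _].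
  by rewrite !ind_ractDl ez ew addrACA.
rewrite !ind_ractE -pureIDl; congr pureI.
elim/tensC_ind: t => [s t es et|i j a a' _ _].
  by rewrite !tensC_ractD es et addrACA.
by rewrite !tensC_ractE mulrDr pureCDr.
Qed.
Lemma ind_ract1 z : ind_ract z 1 = z.
Proof.
elim/ind_ind: z => [z w ez ew|g t m _]; first by rewrite ind_ractDl ez ew.
rewrite ind_ractE; congr pureI.
elim/tensC_ind: t => [s t es et|i j a a' _ _].
  by rewrite tensC_ractD es et.
by rewrite tensC_ractE mulr1.
Qed.
Lemma ind_ractM z x y : ind_ract z (x * y) = ind_ract (ind_ract z x) y.
Proof.
elim/ind_ind: z => [z w ez ew|g t m _]; first by rewrite !ind_ractDl ez ew.
rewrite !ind_ractE; congr pureI.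
elim/tensC_ind: t => [s t es et|i j a a' _ _].
  by rewrite !tensC_ractD es et.
by rewrite !tensC_ractE mulrA.
Qed.
Lemma ind_ract_scale x z y : ind_ract (x *: z) y = x *: ind_ract z y.
Proof.
elim/ind_ind: z => [z w ez ew|g t m _].
  by rewrite scalerDr !ind_ractDl scalerDr ez ew.
rewrite ind_scale_pure !ind_ractE ind_scale_pure; congr pureI.
elim/tensC_ind: t => [s t es et|i j a a' _ _].
  by rewrite !(tensC_lactD, tensC_ractD) es et.
by rewrite !(tensC_lactE, tensC_ractE).
Qed.

Definition ind_part (x : Q) : {pred ind} :=
  zspan (fun z => exists t m, t \in tensC_part A A' x /\ z = pureI t m).

Lemma ind_part_zmod x : zmod_closed (ind_part x).
Proof.
apply: zspan_zmod => z [t [m [tx ->]]].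
by exists (- t), m; rewrite rpredN pureINl.
Qed.
HB.instance Definition _ x :=
  GRing.isZmodClosed.Build ind (ind_part x) (ind_part_zmod x).

Lemma pureI_part x t m : t \in tensC_part A A' x -> pureI t m \in ind_part x.
Proof. by move=> tx; apply: zspan_gen; exists t, m. Qed.

Lemma ind_pr_in x z : ind_pr x z \in ind_part x.
Proof.
elim/ind_ind: z => [z w pz pw|g t m _]; first by rewrite ind_prD rpredD.
by rewrite ind_prE; apply/pureI_part/tensC_pr_in.
Qed.
Lemma ind_pr_sum z : \sum_x ind_pr x z = z.
Proof.
elim/ind_ind: z => [z w ez ew|g t m _].
  rewrite -[RHS](congr2 +%R ez ew) -big_split; apply: eq_bigr => x _.
  exact: ind_prD.
under eq_bigr do rewrite ind_prE.
by rewrite -pureI_suml tensC_pr_sum.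
Qed.
Lemma ind_pr_hom x y z : z \in ind_part y -> ind_pr x z = if x == y then z else 0.
Proof.
move: z; apply: zspan_ind => [|z w ez ew|z [t [m [ty ->]]]].
- by rewrite (morph0 (ind_prD x)) if_same.
- by rewrite ind_prD ez ew; case: eqP; rewrite ?addr0.
by rewrite ind_prE (tensC_pr_hom x ty); case: eqP; rewrite ?pureI0l.
Qed.

Definition ind_grading : grading Q ind :=
  from_proj ind_part_zmod ind_prD ind_pr_in ind_pr_sum ind_pr_hom.

Lemma ind_deg_mul g x h a z y :
  a \in deg A g -> z \in ind_grading x -> y \in deg A' h ->
  ind_ract (a *: z) y \in ind_grading (g * x * h)%g.
Proof.
move=> ag zx yh; move: z zx; apply: zspan_ind => [|z w pz pw|z [t [m [tx ->]]]].
- by rewrite scaler0 (morph0 (ind_ractDl y)) rpred0.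
- by rewrite scalerDr ind_ractDl rpredD.
rewrite ind_scale_pure ind_ractE; apply: pureI_part.
move: t tx; apply: zspan_ind => [|s t ps pt|t [k [l [b [b' [bk bl <- ->]]]]]].
- by rewrite (morph0 (tensC_lactD _)) (morph0 (tensC_ractD _)) rpred0.
- by rewrite tensC_lactD tensC_ractD rpredD.
rewrite tensC_lactE tensC_ractE -mulgA -(mulgA k) mulgA.
by apply: pureC_part; apply: deg_mul.
Qed.

Lemma ind_over g z c : z \in ind_grading g ->
  ind_ract z (zeta A' c) = zeta A (cact C g c) *: z.
Proof.
move: z; apply: zspan_ind => [|z w ez ew|z [t [m [tg ->]]]].
- by rewrite scaler0 (morph0 (ind_ractDl _)).
- by rewrite scalerDr ind_ractDl ez ew.
rewrite ind_scale_pure ind_ractE; congr pureI.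
move: t tg; apply: zspan_ind => [|s t es et|t [k [l [b [b' [bk bl <- ->]]]]]].
- by rewrite (morph0 (tensC_lactD _)) (morph0 (tensC_ractD _)).
- by rewrite tensC_lactD tensC_ractD es et.
rewrite tensC_lactE tensC_ractE -(zeta_comm c bl) -pureC_act.
by rewrite cact_mul (zeta_comm _ bk).
Qed.

Definition ind_bimod : grBimod A A' :=
  GrBimod ind_ractDl ind_ractDr ind_ract1 ind_ractM ind_ract_scale
    ind_deg_mul ind_over.
End Object.

Section Map.
Variables (M N : lmodType D) (f : {linear M -> N}).

Definition ind_map0 : ind M -> ind N := liftI (fun t m => pureI t (f m)).

Lemma ind_map_bal : balancedI (fun t m => pureI t (f m)).
Proof.
split=> [s t m|t m n|t s m]; first by rewrite pureIDl.
  by rewrite raddfD pureIDr.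
by rewrite pureI_mul -linearZ.
Qed.

Lemma ind_map0E t m : ind_map0 (pureI t m) = pureI t (f m).
Proof. exact/liftIE/ind_map_bal. Qed.
Lemma ind_map0D : {morph ind_map0 : x y / x + y}.
Proof. exact/liftID/ind_map_bal. Qed.

Lemma ind_map0_linear : linear ind_map0.
Proof.
move=> a z w; rewrite ind_map0D; congr (_ + _).
elim/ind_ind: z => [x y ex ey|g t m _].
  by rewrite scalerDr !ind_map0D scalerDr ex ey.
by rewrite ind_scale_pure !ind_map0E ind_scale_pure.
Qed.
HB.instance Definition _ :=
  GRing.isLinear.Build A (ind M) (ind N) _ ind_map0 ind_map0_linear.

Lemma ind_map0_ract z y : ind_map0 (ind_ract z y) = ind_ract (ind_map0 z) y.
Proof.
elim/ind_ind: z => [x z ex ez|g t m _].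
  by rewrite ind_ractDl !ind_map0D ind_ractDl ex ez.
by rewrite ind_ractE !ind_map0E ind_ractE.
Qed.

Lemma ind_map0_deg g z : z \in ind_grading M g -> ind_map0 z \in ind_grading N g.
Proof.
move: z; apply: zspan_ind => [|z w pz pw|z [t [m [tg ->]]]].
- by rewrite (morph0 ind_map0D) rpred0.
- by rewrite ind_map0D rpredD.
by rewrite ind_map0E; apply: pureI_part.
Qed.

Definition ind_map : grHom (ind_bimod M) (ind_bimod N) :=
  @GrHom O Q C A A' (ind_bimod M) (ind_bimod N) ind_map0
    ind_map0_ract ind_map0_deg.
End Map.

Lemma ind_map_id (M : lmodType D) :
  ind_map (idfun : {linear M -> M}) = grHom_id (ind_bimod M).
Proof.
apply: grHom_eq => z; rewrite /=.
elim/ind_ind: z => [x y ex ey|g t m _]; first by rewrite ind_map0D ex ey.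
by rewrite ind_map0E.
Qed.

Lemma ind_map_comp (M N P : lmodType D) (g : {linear N -> P})
    (f : {linear M -> N}) :
  ind_map (g \o f : {linear M -> P}) = grHom_comp (ind_map g) (ind_map f).
Proof.
apply: grHom_eq => z /=.
elim/ind_ind: z => [x y ex ey|k t m _]; last by rewrite !ind_map0E.
by rewrite !ind_map0D ex ey.
Qed.

Definition ind_functor : functor (mod_cat D) (grBimod_cat A A') :=
  @Functor (mod_cat D) (grBimod_cat A A') ind_bimod ind_map
    ind_map_id ind_map_comp.
End Induction.

(* Main.v *)
(* The maps t (x) m |-> pr_1(t) m and m |-> (1 (x) 1) (x) m identify the      *)
(* identity component of the induced bimodule of M with M.  Conversely, the   *)
(* bimodule induced from M_1 maps to M by t (x) m |-> t m.  The inverse sends *)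
(* m in M_g to (u (x) 1) (x) u^-1 m, where u is a homogeneous unit of degree  *)
(* g: for a and a' homogeneous with a m a' of degree g, the element           *)
(* u^-1 a (x) a' is diagonal, so it can be moved across the tensor product.   *)
Require Import Defs.
From HB Require Import structures.
From mathcomp Require Import all_boot all_fingroup all_algebra.
From mathcomp Require Import boolp.

Set Implicit Arguments.
Unset Strict Implicit.
Unset Printing Implicit Defensive.

Import GRing.Theory.
Local Open Scope ring_scope.

(** This is Dade's theorem for graded bimodules. Write $T=A\otimes_{\mathcal{C}}A'^{\mathrm{op}}$
    and let $u\in A$ be a homogeneous unit of degree $g$. Then
    $T_g=(u\otimes1)\Delta^{\mathcal{C}}$, because $a\otimes a'=(u\otimes1)(u^{-1}a\otimes a')$ and
    the last factor is diagonal. So each component of an induced bimodule is a shifted copy of the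
    module; likewise $\tilde M_g=u\tilde M_1$, and $\tilde M$ is recovered from $\tilde M_1$. The
    two composites that use balancing over $\Delta^{\mathcal{C}}$ are [pureI_one_evaluate] and
    [ind_actK]; the opposite ones, [ind_insertK] and [ind_act_invK], are direct computations. *)

Lemma linear_can_sym (R : pzRingType) (U V : lmodType R) (f : U -> V)
    (g : V -> U) :
  linear f -> cancel f g -> cancel g f -> linear g.
Proof.
by move=> fl fK gK a x y; rewrite -[in LHS](gK x) -[in LHS](gK y) -fl fK.
Qed.

Section Equivalence.
Variables (O : comPzRingType) (Q : finGroupType) (C : actedAlg O Q).
Variables A A' : crossedOver C.
Local Notation T := (tensC A A').
Local Notation D := (Delta A A').
(* [ract] alone would denote the restriction of a group action. *)
Local Notation ract := Defs.ract.

(** * The identity component of an induced bimodule *)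

Section IdentityComponentOfInd.
Variable M : lmodType D.

Definition diag_proj (t : T) : D :=
  @Component _ _ (tensC_grading A A') 1%g (tensC_pr 1%g t) (tensC_pr_in 1%g t).

Lemma diag_projD : {morph diag_proj : s t / s + t}.
Proof. by move=> s t; apply/Delta_val_inj/tensC_prD. Qed.

Lemma diag_proj_val (t : D) : diag_proj (Delta_val t) = t.
Proof.
apply: Delta_val_inj; rewrite /Delta_val /=.
by rewrite (tensC_pr_hom _ (Delta_valP t)) eqxx.
Qed.

(** Right multiplication by a diagonal element preserves degrees; this makes evaluation through
    [diag_proj] balanced. *)
Lemma diag_proj_mul t (s : D) :
  diag_proj (tensC_mul t (Delta_val s)) = diag_proj t * s.
Proof. exact/Delta_val_inj/tensC_pr_mul. Qed.

Lemma ind_evaluate_bal :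
  balancedI (M := M) (fun t m => diag_proj t *: m).
Proof.
split=> [s t m|t m n|t s m]; first by rewrite diag_projD scalerDl.
  by rewrite scalerDr.
by rewrite /diag_ract diag_proj_mul -scalerA.
Qed.

Definition ind_evaluate (z : ind M) : M := liftI (fun t m => diag_proj t *: m) z.

Lemma ind_evaluateE t m : ind_evaluate (pureI t m) = diag_proj t *: m.
Proof. exact/liftIE/ind_evaluate_bal. Qed.

Lemma ind_evaluateD : {morph ind_evaluate : x y / x + y}.
Proof. exact/liftID/ind_evaluate_bal. Qed.

Lemma pureI_one_part m : pureI (tensC_one A A') m \in ind_grading M 1%g.
Proof. by apply: pureI_part; apply: tensC_one_part. Qed.

Definition ind_insert (m : M) : idcomp (ind_bimod M) :=
  @Component _ _ (ind_grading M) 1%g _ (pureI_one_part m).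

(** For a pure tensor this is $a(1\otimes1)a'=a\otimes a'$. *)
Lemma tensC_act_pureI_one t m :
  tensC_act (M := ind_bimod M) t (pureI (tensC_one A A') m) = pureI t m.
Proof.
have m1 := pureI_one_part m.
elim/tensC_ind: t => [s t es et|i j a a' _ _].
  by rewrite (@tensC_actDl _ _ _ _ _ (ind_bimod M)) // es et pureIDl.
rewrite (@tensC_act_pure _ _ _ _ _ (ind_bimod M)) //=.
by rewrite ind_scale_pure ind_ractE tensC_lactE tensC_ractE mulr1 mul1r.
Qed.

Lemma pureI_one_scale (s : D) (m : M) :
  pureI (tensC_one A A') (s *: m) = pureI (Delta_val s) m.
Proof.
rewrite -pureI_mul tensC_mul1r.
by rewrite (tensC_pr_hom _ (Delta_valP s)) eqxx.
Qed.

(** Linearity is checked on this side, where the action is explicit, and passes to [idcomp_evaluate]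
    by [linear_can_sym]. *)
Lemma ind_insert_linear : linear ind_insert.
Proof.
move=> s m n; apply: idcomp_val_inj; rewrite /idcomp_val /= pureIDr.
congr (_ + _); rewrite pureI_one_scale.
by symmetry; apply: tensC_act_pureI_one.
Qed.

HB.instance Definition _ :=
  GRing.isLinear.Build D M (idcomp (ind_bimod M)) _ ind_insert ind_insert_linear.

Definition idcomp_evaluate (z : idcomp (ind_bimod M)) : M :=
  ind_evaluate (idcomp_val z).

Lemma ind_insertK : cancel ind_insert idcomp_evaluate.
Proof.
move=> m; rewrite /idcomp_evaluate /idcomp_val /= ind_evaluateE.
by rewrite -Delta_val1 diag_proj_val scale1r.
Qed.

(** For diagonal $t$, $t\otimes m=(1\otimes1)t\otimes m=(1\otimes1)\otimes tm$. Degree 1 matters: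
    [ind_evaluate] kills the other components. *)
Lemma pureI_one_evaluate (z : ind M) : z \in ind_part 1%g ->
  pureI (tensC_one A A') (ind_evaluate z) = z.
Proof.
move: z; apply: zspan_ind => [|z w ez ew|z [t [m [t1 ->]]]].
- by rewrite (morph0 ind_evaluateD); apply: morph0 => m n; apply: pureIDr.
- by rewrite ind_evaluateD pureIDr ez ew.
rewrite ind_evaluateE pureI_one_scale /Delta_val /=.
by rewrite (tensC_pr_hom _ t1) eqxx.
Qed.

Lemma idcomp_evaluateK : cancel idcomp_evaluate ind_insert.
Proof. by move=> z; apply/idcomp_val_inj/pureI_one_evaluate/(cvalP z). Qed.

HB.instance Definition _ :=
  GRing.isLinear.Build D (idcomp (ind_bimod M)) M _ idcomp_evaluate
    (linear_can_sym ind_insert_linear ind_insertK idcomp_evaluateK).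
End IdentityComponentOfInd.

Lemma idcomp_evaluate_natural (M N : lmodType D) (f : {linear M -> N}) z :
  idcomp_evaluate (idcomp_map (ind_map f) z) = f (idcomp_evaluate z).
Proof.
(* Every [z] is an inserted element, so naturality reduces to that of [ind_insert]. *)
rewrite -[z]idcomp_evaluateK ind_insertK -[RHS]ind_insertK; congr idcomp_evaluate.
by apply: idcomp_val_inj; apply: ind_map0E.
Qed.

Lemma idcomp_ind_iso :
  naturally_isomorphic (comp_functor (idcomp_functor A A') (ind_functor A A'))
    (id_functor (mod_cat D)).
Proof.
exists (fun M : lmodType D => @idcomp_evaluate M : {linear _ -> _}),
  (fun M : lmodType D => @ind_insert M : {linear _ -> _}); split=> [M N f|M|M].
- by apply: linear_eq => z; apply: idcomp_evaluate_natural.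
- by apply: linear_eq => z; apply: idcomp_evaluateK.
by apply: linear_eq => m; apply: ind_insertK.
Qed.

(** * The bimodule induced from an identity component *)

Section IndOfIdentityComponent.
Variable M : grBimod A A'.

(** Balancing is the associativity [tensC_act_mul], available because the second factor is diagonal
    and the vector has degree 1. *)
Lemma ind_act_bal :
  balancedI (M := idcomp M) (fun t m => tensC_act t (idcomp_val m)).
Proof.
split=> [s t m|t m n|t s m].
- exact/tensC_actDl/idcomp_valP.
- by apply: tensC_actDr; apply: idcomp_valP.
exact/tensC_act_mul/idcomp_valP/Delta_valP.
Qed.

Definition ind_act (z : ind (idcomp M)) : M :=
  liftI (fun t m => tensC_act t (idcomp_val m)) z.

Lemma ind_actE t m : ind_act (pureI t m) = tensC_act t (idcomp_val m).
Proof. exact/liftIE/ind_act_bal. Qed.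

Lemma ind_actD : {morph ind_act : x y / x + y}.
Proof. exact/liftID/ind_act_bal. Qed.

Lemma ind_act_linear : linear ind_act.
Proof.
move=> a z w; rewrite ind_actD; congr (_ + _).
elim/ind_ind: z => [x y ex ey|g t m _].
  by rewrite scalerDr !ind_actD scalerDr ex ey.
rewrite ind_scale_pure !ind_actE; have m1 := idcomp_valP m.
elim/tensC_ind: t => [s t es et|i j b b' _ _].
  by rewrite tensC_lactD !tensC_actDl // es et scalerDr.
by rewrite tensC_lactE !tensC_act_pure // -scalerA ract_scale.
Qed.

HB.instance Definition _ :=
  GRing.isLinear.Build A (ind (idcomp M)) M _ ind_act ind_act_linear.

Lemma ind_act_ract z y : ind_act (ind_ract z y) = ract (ind_act z) y.
Proof.
elim/ind_ind: z => [z w ez ew|g t m _].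
  by rewrite ind_ractDl !ind_actD ractDl ez ew.
rewrite ind_ractE !ind_actE; have m1 := idcomp_valP m.
elim/tensC_ind: t => [s t es et|i j b b' _ _].
  by rewrite tensC_ractD !tensC_actDl // es et ractDl.
by rewrite tensC_ractE !tensC_act_pure // ractM.
Qed.

Lemma ind_act_deg g z :
  z \in ind_grading (idcomp M) g -> ind_act z \in gb_deg M g.
Proof.
move: z; apply: zspan_ind => [|z w pz pw|z [t [m [tg ->]]]].
- by rewrite (morph0 ind_actD) rpred0.
- by rewrite ind_actD rpredD.
by rewrite ind_actE; apply/tensC_act_deg/idcomp_valP.
Qed.

Definition ind_act_hom : grHom (ind_bimod (idcomp M)) M :=
  @GrHom _ _ _ _ _ (ind_bimod (idcomp M)) M ind_act ind_act_ract ind_act_deg.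

Definition homog_unit (g : Q) : A := s2val (cid2 (co_crossed A g)).

Lemma homog_unit_deg g : homog_unit g \in deg A g.
Proof. exact: (s2valP (cid2 (co_crossed A g))). Qed.

Lemma homog_unit_inverse g :
  exists2 v, v \in deg A g^-1%g & inverses (homog_unit g) v.
Proof.
have [v uv] := s2valP' (cid2 (co_crossed A g)).
by exists v => //; apply: deg_inv uv; apply: homog_unit_deg.
Qed.

Definition homog_inv (g : Q) : A := s2val (cid2 (homog_unit_inverse g)).

Lemma homog_inv_deg g : homog_inv g \in deg A g^-1%g.
Proof. exact: (s2valP (cid2 (homog_unit_inverse g))). Qed.

Lemma homog_unitV g : homog_unit g * homog_inv g = 1.
Proof. by have [] := s2valP' (cid2 (homog_unit_inverse g)). Qed.

Lemma homog_inv_scale_deg g m :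
  homog_inv g *: gproj (gb_deg M) g m \in gb_deg M 1%g.
Proof.
rewrite -[X in X \in _]ract1 -(mulVg g) -[(_ * _)%g]mulg1.
by apply: gb_deg_mul; [apply: homog_inv_deg|apply: gproj_in|apply: deg1].
Qed.

(** Projecting to degree $g$ before multiplying makes this total and additive on [M]. *)
Definition homog_shift (g : Q) (m : M) : idcomp M :=
  @Component _ _ (gb_deg M) 1%g _ (homog_inv_scale_deg g m).

Lemma homog_shiftD g : {morph homog_shift g : m n / m + n}.
Proof.
by move=> m n; apply: idcomp_val_inj; rewrite /idcomp_val /= gprojD scalerDr.
Qed.

Definition ind_act_inv (m : M) : ind (idcomp M) :=
  \sum_g pureI (pureC (homog_unit g) 1) (homog_shift g m).

Lemma ind_act_invD : {morph ind_act_inv : m n / m + n}.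
Proof.
move=> m n; rewrite /ind_act_inv -big_split; apply: eq_bigr => g _.
by rewrite homog_shiftD pureIDr.
Qed.

Lemma ind_act_inv_homog g m : m \in gb_deg M g ->
  ind_act_inv m = pureI (pureC (homog_unit g) 1) (homog_shift g m).
Proof.
move=> mg; rewrite /ind_act_inv (bigD1 g) //= big1 ?addr0 // => h hg.
rewrite [homog_shift h m](_ : _ = 0).
  by apply: (morph0 (f := pureI _)) => x y; apply: pureIDr.
by apply: idcomp_val_inj; rewrite /idcomp_val /= (gproj_hom h mg) (negPf hg) scaler0.
Qed.

Lemma ind_act_inv_deg g m :
  m \in gb_deg M g -> ind_act_inv m \in ind_grading (idcomp M) g.
Proof.
move=> mg; rewrite (ind_act_inv_homog mg); apply: pureI_part.
by rewrite -[g in tensC_part _ _ g]mulg1; apply: pureC_part (homog_unit_deg g) (deg1 A').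
Qed.

Lemma ind_act_invK : cancel ind_act_inv ind_act.
Proof.
move=> m; elim/(grading_ind (gr := gb_deg M)): m => [m n em en|g m mg].
  by rewrite ind_act_invD ind_actD em en.
rewrite (ind_act_inv_homog mg) ind_actE tensC_act_pure; last exact: idcomp_valP.
by rewrite ract1 /idcomp_val /= (gproj_id mg) scalerA homog_unitV scale1r.
Qed.

(** Any $a\otimes a'$ of degree $g$ factors as $u\otimes1$ times a diagonal tensor, which balancing
    moves onto [m]. *)
Lemma ind_actK : cancel ind_act ind_act_inv.
Proof.
move=> z; elim/ind_ind: z => [z w ez ew|_ t m _].
  by rewrite ind_actD ind_act_invD ez ew.
elim/tensC_ind: t => [s t es et|i j a a' ai aj].
  by rewrite pureIDl ind_actD ind_act_invD es et.
have amx : ract (a *: idcomp_val m) a' \in gb_deg M (i * j)%g.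
  by rewrite -[i]mulg1; apply: gb_deg_mul => //; apply: idcomp_valP.
rewrite ind_actE (tensC_act_pure _ _ (idcomp_valP m)) (ind_act_inv_homog amx).
set u := homog_unit _; set v := homog_inv (i * j)%g.
have vai : v * a \in deg A j^-1%g.
  have -> : (j^-1 = (i * j)^-1 * i)%g by rewrite invMg mulgKV.
  exact: deg_mul (homog_inv_deg _) ai.
have va1 : pureC (v * a) a' \in tensC_part A A' 1%g.
  by rewrite -(mulVg j); apply: pureC_part.
(* The diagonal factor $u^{-1}a\otimes a'$, with degrees $j^{-1}$ and $j$. *)
pose s : D := @Component _ _ (tensC_grading A A') 1%g _ va1.
have -> : homog_shift (i * j)%g (ract (a *: idcomp_val m) a') = s *: m.
  apply: idcomp_val_inj; rewrite [RHS](tensC_act_pure _ _ (idcomp_valP m)).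
  by rewrite /idcomp_val /= (gproj_id amx) -scalerA [in RHS]ract_scale.
(* Back across the tensor sign: $(u\otimes1)(va\otimes a')=uva\otimes a'=a\otimes a'$. *)
rewrite -pureI_mul (tensC_mul_pure _ _ vai) ?invgK // mulr1 mulrA.
by rewrite homog_unitV mul1r.
Qed.

HB.instance Definition _ :=
  GRing.isLinear.Build A M (ind (idcomp M)) _ ind_act_inv
    (linear_can_sym ind_act_linear ind_actK ind_act_invK).

Lemma ind_act_inv_ract m y : ind_act_inv (ract m y) = ind_ract (ind_act_inv m) y.
Proof. by rewrite -[RHS]ind_actK ind_act_ract ind_act_invK. Qed.

Definition ind_act_inv_hom : grHom M (ind_bimod (idcomp M)) :=
  @GrHom _ _ _ _ _ M (ind_bimod (idcomp M)) ind_act_inv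
    ind_act_inv_ract ind_act_inv_deg.
End IndOfIdentityComponent.

Lemma ind_act_natural (M N : grBimod A A') (f : grHom M N) z :
  ind_act (ind_map0 (idcomp_map f) z) = f (ind_act z).
Proof.
elim/ind_ind: z => [z w ez ew|g t m _].
  by rewrite ind_map0D !ind_actD raddfD /= ez ew.
by rewrite ind_map0E !ind_actE tensC_act_map //; apply: idcomp_valP.
Qed.

Lemma ind_idcomp_iso :
  naturally_isomorphic (comp_functor (ind_functor A A') (idcomp_functor A A'))
    (id_functor (grBimod_cat A A')).
Proof.
exists ind_act_hom, ind_act_inv_hom; split=> [M N f|M|M].
- by apply: grHom_eq => z; apply: ind_act_natural.
- by apply: grHom_eq => z; apply: ind_actK.
by apply: grHom_eq => m; apply: ind_act_invK.
Qed.
End Equivalence.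

Theorem theorem2p10 (O : idomainType) (O_complete_dvr : complete_dvr O)
    (gT : finGroupType) (N : {group gT}) (N_normal : (N <| [set: gT])%g)
    (C : actedAlg O (coset_of N)) (A A' : crossedOver C) :
  quasi_inverse (ind_functor A A') (idcomp_functor A A').
Proof. by split; [apply: idcomp_ind_iso|apply: ind_idcomp_iso]. Qed.
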